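(* A closed convex set-valued mapping $X$ from $\Omega$ to subsets of $\mathfrak{X}$ is $\mathcal{F}$-measurable (that is, is a random closed set) if and only if $\operatorname{epi} h_X$ is an $\mathcal{F}$-measurable random closed set with values in $\mathcal{E}$.
   Context: $\mathfrak{X}$ is a separable real Banach space with Borel $\sigma$-algebra $\mathcal{B}(\mathfrak{X})$; $(\Omega,\mathcal{F},\mathbf{P})$ is a complete probability space. $\mathfrak{X}^*$ is the dual space with pairing $\langle u,x\rangle$, equipped with the $\sigma(\mathfrak{X}^*,\mathfrak{X})$-topology and the corresponding Borel $\sigma$-algebra. A set-valued mapping with values in $\mathfrak{X}$ (respectively in $\mathfrak{X}^*\times\mathbb{R}$, with the product of the $\sigma(\mathfrak{X}^*,\mathfrak{X})$-topology and the Euclidean topology) is $\mathcal{F}$-measurable if its graph, e.g. $\{(\omega,x):x\in X(\omega)\}$, belongs to the product of $\mathcal{F}$ and the Borel $\sigma$-algebra of the space; an $\mathcal{F}$-measurable mapping is called a random set, and a random closed set if its values are closed for almost all $\omega$. The support function is $h_X(u)=\sup\{\langle u,x\rangle:\ x\in X\}$, $u\in\mathfrak{X}^*$ (equal to $-\infty$ for the empty set). The epigraph of $f:\mathfrak{X}^*\to[-\infty,\infty]$ is $\operatorname{epi} f=\{(u,t)\in\mathfrak{X}^*\times\mathbb{R}:\ f(u)\leq t\}$. $\mathcal{E}$ is the family of subsets of $\mathfrak{X}^*\times\mathbb{R}$ that are closed in the product of the $\sigma(\mathfrak{X}^*,\mathfrak{X})$-topology on $\mathfrak{X}^*$ and the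 Euclidean topology on $\mathbb{R}$, are convex cones, and with each element $(u,t)$ contain $(u,s)$ for all $s\geq t$. *)

(* Defs.v *)
From HB Require Import structures.
From mathcomp Require Import all_boot all_order all_algebra.
From mathcomp Require Import all_classical all_reals all_analysis.

Set Implicit Arguments.
Unset Strict Implicit.
Unset Printing Implicit Defensive.

Import Order.TTheory GRing.Theory Num.Theory.
Import numFieldNormedType.Exports.

Local Open Scope classical_set_scope.
Local Open Scope ring_scope.

Definition separable (T : topologicalType) : Prop :=
  exists2 D : set T, countable D & dense D.

Section Dual.
Variables (R : realType) (V : normedModType R).

Definition continuous_linear : {pred V -> R^o} :=
  fun f => `[< linear f /\ continuous f >].

Fact continuous_linear_submod_closed : submod_closed continuous_linear.
Proof.
split.
  apply/asboolP; split; last exact: cst_continuous.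
  by move=> a x y; rewrite /= scaler0 addr0.
move=> a f g /asboolP[lf cf] /asboolP[lg cg]; apply/asboolP; split.
  move=> b x y; change (a *: f (b *: x + y) + g (b *: x + y) =
    b *: (a *: f x + g x) + (a *: f y + g y)).
  by rewrite lf lg !scalerDr !scalerA (mulrC a b) addrACA.
by move=> x; apply: cvgD; [apply: cvgZr; exact: cf|exact: cg].
Qed.

HB.instance Definition _ :=
  GRing.isSubmodClosed.Build R (V -> R^o) continuous_linear
    continuous_linear_submod_closed.

Record dual_space := DualSpace {
  dual_fun :> V -> R^o;
  dual_funP : dual_fun \in continuous_linear }.

HB.instance Definition _ := [isSub for dual_fun].
HB.instance Definition _ := [Choice of dual_space by <:].
HB.instance Definition _ := [SubChoice_isSubLmodule of dual_space by <:].

HB.instance Definition _ := isPointed.Build dual_space 0.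

(* sigma(V^*, V): the coarsest topology making every evaluation u |-> u x
   continuous, not the operator-norm topology *)
HB.instance Definition _ := Topological.copy dual_space
  (initial_topology (dual_fun : dual_space -> {ptws V -> R^o})).

End Dual.

(* the library does not derive the join of its pointed and topological
   structures on a product *)
HB.instance Definition _ (T U : ptopologicalType) :=
  Topological.on (T * U)%type.

Definition borelType (T : ptopologicalType) := g_sigma_algebraType (@open T).
HB.instance Definition _ (T : ptopologicalType) :=
  Measurable.on (borelType T).

Section RandomSets.
Context d (Omega : measurableType d) (R : realType) (P : probability Omega R).
Variable S : ptopologicalType.
Implicit Type X : Omega -> set S.

Definition graph_measurable X : Prop :=
  measurable ([set z | X z.1 z.2] : set (Omega * borelType S)).

Definition random_closed_set X : Prop :=
  graph_measurable X /\ {ae P, forall w, closed (X w)}.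

End RandomSets.

Section SupportFunction.
Variables (R : realType) (V : normedModType R).

(* -oo on the empty set, since ereal_sup set0 = -oo *)
Definition support_function (A : set V) (u : dual_space V) : \bar R :=
  ereal_sup [set (u x)%:E | x in A].

Definition epi (f : dual_space V -> \bar R) : set (dual_space V * R^o) :=
  [set z | (f z.1 <= (z.2)%:E)%E].

End SupportFunction.

Definition cone (R : realType) (M : lmodType R) (A : set M) : Prop :=
  forall (a : R) (x : M), 0 < a -> A x -> A (a *: x).

Definition epi_family (R : realType) (V : normedModType R) :
    set (set (dual_space V * R^o)) :=
  [set A : set (dual_space V * R^o)%type | [/\ closed A, convex_set A, cone A
     & forall (u : dual_space V) (t s : R), A (u, t) -> t <= s -> A (u, s)]].

(* Main.v *)
From HB Require Import structures.
Require Import Defs.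
From mathcomp Require Import all_boot all_order all_algebra.
From mathcomp Require Import all_classical all_reals all_analysis.
From mathcomp Require Import lra.

Import Order.TTheory GRing.Theory Num.Theory.
Import numFieldNormedType.Exports.

Local Open Scope classical_set_scope.
Local Open Scope ring_scope.

(** The two graphs are exchanged by one countable decomposition of the relation
[t < u x].  Fix a dense sequence [c] of the Banach space.  By continuity of [u],
[t < u x] holds exactly when, for some [n] and [k], the point [x] lies in the
ball [B n k] of centre [c n] and radius [1/(k+1)] while the pair [(u, t)] lies
in the weak-* closed set [G n k] of those [(v, s)] with [s + 1/(k+1) <= v] on
[B n k] (dual_gt_level_box).  Hence
- [(u, t)] is outside the epigraph of the support function of [X w] iff, for
  some [n], [k], the set [X w] meets [B n k] and [(u, t)] is in [G n k];
- by Hahn-Banach separation (convex_closed_separation), [x] is outside [X w]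
  iff, for some [n], [k], the epigraph meets [G n k] and [x] is in [B n k].
So the complement of either graph is a countable union of rectangles, and what
has to be shown is that the hitting events [{w | X w meets B n k}] and
[{w | epi h_(X w) meets G n k}] are measurable.

These events are projections to the probability space of sets measurable in the
product with a Borel space, and this is where completeness enters: the
measurable projection theorem (measurable_projection).  Its proof has two
halves.  A Souslin operation performed on measurable sets gives a measurable set
when the probability is complete (souslin_measurable): replacing each node of
the scheme by a measurable hull costs countably many null sets, and outside of
them a branch can be followed greedily.  On the topological side, points of the
second factor are coded by sequences of natural numbers, through a sequence of
countable covers such that every code whose finite intersections are nonempty
has a limit point (complete_cover).  Relatively to such codes, the sets that are
Souslin together with their complements form a sigma-algebra containing the
measurable rectangles.

Both spaces have such covers: the separable Banach space by closed balls of
vanishing radius, and the product of the dual with the line by prescribing a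
norm bound and rational approximations of the real coordinate and of the values
of the functional on the dense sequence (weak_dual_complete_cover). *)

(** * Souslin operations on a complete probability space *)

Section Souslin_operation.
Context {d : measure_display} {Omega : measurableType d} {R : realType}.
Variable P : probability Omega R.

(** The hull is the intersection of a sequence of measurable supersets whose
probabilities approach the infimum over all measurable supersets.  Minimality is
stated against every measurable superset because that is what makes the defect
of a hull against a union of hulls negligible. *)
Lemma measurable_hull (A : set Omega) :
  exists E, [/\ measurable E, A `<=` E &
    forall F, measurable F -> A `<=` F -> P (E `\` F) = 0%E].
Proof.
pose I := [set P F | F in [set F : set Omega | measurable F /\ A `<=` F]].
have I_fin : ereal_inf I \is a fin_num.
  rewrite ge0_fin_numE.
    apply: (@le_lt_trans _ _ (P setT)); last by rewrite probability_setT ltry.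
    by apply: ereal_inf_lbound; exists setT.
  by apply: le_ereal_inf_tmp => _ [F _ <-]; exact: measure_ge0.
have /choice[F FP] n : exists F, [/\ measurable F, A `<=` F &
    (P F < ereal_inf I + (n.+1%:R^-1)%:E)%E].
  have [_ [F [mF AF] <-] Fn] := lb_ereal_inf_adherent
    (ltac:(by rewrite invr_gt0 ltr0n) : 0 < n.+1%:R^-1 :> R) I_fin.
  by exists F.
exists (\bigcap_n F n); split.
- by apply: bigcapT_measurable => n; case: (FP n).
- by move=> w Aw n _; have [_ + _] := FP n; exact.
move=> G mG AG; set E := \bigcap_n F n.
have mE : measurable E by apply: bigcapT_measurable => n; case: (FP n).
have PE : (P E <= ereal_inf I)%E.
  apply/lee_addgt0Pr => e e0.
  have [n _ /(_ n (leqnn n)) ne] : \forall n \near \oo, n.+1%:R^-1 < e.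
    exact: near_infty_natSinv_lt (PosNum e0).
  have [mFn _ PFn] := FP n.
  apply: (@le_trans _ _ (P (F n))).
    by apply: le_measure; rewrite ?inE//; exact: bigcap_inf.
  by apply: (le_trans (ltW PFn)); rewrite leeD2l// lee_fin ltW.
have IG : (ereal_inf I <= P (E `&` G))%E.
  apply: ereal_inf_lbound; exists (E `&` G) => //; split.
    exact: measurableI.
  move=> w Aw; split; [|exact: AG].
  by move=> n _; have [_ + _] := FP n; exact.
have := @measureDI _ _ _ P E G mE mG => EDI.
apply/eqP; rewrite eq_le measure_ge0 andbT.
have finI : P (E `&` G) \is a fin_num.
  by apply: fin_num_measure; exact: measurableI.
by rewrite -(leeD2rE _ _ finI) add0e -EDI (le_trans PE).
Qed.

Hypothesis completeP : measure_is_complete P.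

(** Let [pr s] be the set of points having a branch through the node [s], and
[E s] a measurable hull of it inside [M s].  Since [pr s] is the union of the
[pr (rcons s i)], the measurable set [D s] of points of [E s] that lie in no
[E (rcons s i)] is null.  A point of [E [::]] avoiding all the [D s] can be
moved from node to node for ever, so it belongs to the Souslin set; hence the
latter differs from [E [::]] by a null set, and completeness concludes. *)
Lemma souslin_measurable (I : countType) (M : seq I -> set Omega) :
  (forall s, measurable (M s)) ->
  measurable [set w | exists r : nat -> I, forall n, M (mkseq r n) w].
Proof.
move=> mM.
pose pr s := [set w | exists2 r : nat -> I,
  mkseq r (size s) = s & forall n, M (mkseq r n) w].
have prM s : pr s `<=` M s by move=> w [r rs Mr]; rewrite -rs.
have pr_rcons s : pr s `<=` \bigcup_i pr (rcons s i).
  move=> w [r rs Mr]; exists (r (size s)) => //; exists r => //.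
  by rewrite size_rcons mkseqS rs.
have /choice[E0 E0P] s := measurable_hull (pr s).
pose E s := E0 s `&` M s.
have mE s : measurable (E s) by apply: measurableI => //; case: (E0P s).
have prE s : pr s `<=` E s.
  by move=> w prw; split; [case: (E0P s) => _ + _; exact|exact: prM].
pose D s := E s `\` \bigcup_i E (rcons s i).
have mU s : measurable (\bigcup_i E (rcons s i)).
  by apply: countable_bigcupT_measurable => //; exact: countableP.
have D0 s : P.-negligible (D s).
  exists (E0 s `\` \bigcup_i E (rcons s i)); split.
  - by apply: measurableD => //; case: (E0P s).
  - case: (E0P s) => _ _; apply=> // w /pr_rcons[i _ prw].
    by exists i => //; exact: prE.
  - by move=> w [[E0w _] ?].
have N0 : P.-negligible
    (\bigcup_n (if @unpickle (seq I) n is Some s then D s else set0)).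
  by apply: negligible_bigcup => n; case: unpickle => // ; exact: negligible_set0.
have EN : E [::] `\` pr [::] `<=`
    \bigcup_n (if @unpickle (seq I) n is Some s then D s else set0).
  move=> w [Ew npr]; apply: contrapT => nN; apply: npr.
  have next s : exists i, E s w -> E (rcons s i) w.
    have [Es|nEs] := pselect (E s w).
      have [[i _ Ei]|nEi] := pselect ((\bigcup_i E (rcons s i)) w).
        by exists i.
      by exfalso; apply: nN; exists (pickle s) => //; rewrite pickleK.
    have [i|noI] := pselect (exists i : I, True).
      by case: i => i _; exists i.
    exfalso; apply: noI; case: s nEs => [/(_ Ew)//|i s _]; by exists i.
  have [f fP] := choice next.
  pose b := fix b n := if n is m.+1 then rcons (b m) (f (b m)) else [::].
  have bE n : E (b n) w by elim: n => [//|n IH] /=; exact: fP.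
  have bM n : mkseq (fun n => f (b n)) n = b n.
    by elim: n => [//|n IH]; rewrite mkseqS IH.
  by exists (fun n => f (b n)) => // n; rewrite bM; case: (bE n).
have -> : [set w | exists r : nat -> I, forall n, M (mkseq r n) w] =
    E [::] `\` (E [::] `\` pr [::]).
  rewrite setDD setIidr//.
  by apply/seteqP; split=> w [r Mr]; exists r.
apply: measurableD => //; apply: completeP.
exact: negligibleS EN N0.
Qed.

End Souslin_operation.

(** * The measurable projection theorem *)

(** A level-by-level coding of the points of [S] by sequences: [r] codes [s]
when [s] belongs to [C k (r k)] for all [k].  The second field is a form of
completeness of [S], the third says that a code determines the neighbourhoods of
the points it codes. *)
Record complete_cover {S : topologicalType} (C : nat -> nat -> set S) : Prop :=
  CompleteCover {
    complete_cover_total : forall s k, exists i, C k i s;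
    complete_cover_inhabited : forall r : nat -> nat,
      (forall n, exists s, forall k, (k < n)%N -> C k (r k) s) ->
      exists s, forall k, C k (r k) s;
    complete_cover_shrink : forall (r : nat -> nat) s (U : set S),
      (forall k, C k (r k) s) -> open U -> U s ->
      exists n, forall s', (forall k, (k < n)%N -> C k (r k) s') -> U s' }.

Arguments complete_cover_total {S C}.
Arguments complete_cover_inhabited {S C}.
Arguments complete_cover_shrink {S C}.

Lemma measurable_constant_prop {d : measure_display} {T : measurableType d}
    (Q : Prop) : measurable [set _ : T | Q].
Proof.
have [q|nq] := pselect Q.
  by rewrite (_ : [set _ | _] = setT)//; apply/seteqP; split.
by rewrite (_ : [set _ | _] = set0)//; apply/seteqP; split.
Qed.

Section coded_Souslin.
Context {d : measure_display} {Omega : measurableType d} {S : topologicalType}.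
Variable C : nat -> nat -> set S.

(** The analytic subsets of the product, seen through the codes of their
points.  Membership may use both a code [r] of the second coordinate and an
auxiliary sequence [t], but each condition looks only at finite prefixes of
them.  Quantifying over all codes [r] of [s] makes sets with different
witnesses [M] comparable along a common code, which countable intersections
require. *)
Definition coded_souslin (A : set (Omega * S)) : Prop :=
  exists2 M : seq nat -> seq nat -> set Omega,
    forall rho tau, measurable (M rho tau) &
    forall w s r, (forall k, C k (r k) s) ->
      A (w, s) <-> exists t, forall n, M (mkseq r n) (mkseq t n) w.

Lemma take_mkseq (T : Type) (f : nat -> T) (m n : nat) :
  (m <= n)%N -> take m (mkseq f n) = mkseq f m.
Proof. by move=> mn; rewrite /mkseq -map_take take_iota (minn_idPl mn). Qed.

Lemma mkseq_cons (T : Type) (f : nat -> T) (n : nat) :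
  mkseq f n.+1 = f 0%N :: mkseq (fun i => f i.+1) n.
Proof. by rewrite /mkseq /= -[1%N]addn0 iotaDl -map_comp. Qed.

(** The first term of the auxiliary sequence announces which set of the family
the point belongs to, and the rest is a witness for that set. *)
Lemma coded_souslin_bigcup (A : nat -> set (Omega * S)) :
  (forall j, coded_souslin (A j)) -> coded_souslin (\bigcup_j A j).
Proof.
move=> Asouslin.
have /choice[M MP] j : exists M : seq nat -> seq nat -> set Omega,
    (forall rho tau, measurable (M rho tau)) /\
    forall w s r, (forall k, C k (r k) s) ->
      A j (w, s) <-> exists t, forall n, M (mkseq r n) (mkseq t n) w.
  by have [M mM AM] := Asouslin j; exists M.
pose M' rho tau := if tau is j :: tau' then
  M j (take (size tau') rho) tau' else setT.
exists M'.
  by move=> rho [|j tau]; [exact: measurableT|have [+ _] := MP j; exact].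
move=> w s r rs; split=> [[j _ Aj]|[t Mt]].
  have [_ /(_ w s r rs)[/(_ Aj)[t Mt] _]] := MP j.
  exists (fun n => if n is m.+1 then t m else j) => -[//|n].
  rewrite [X in M' _ X]mkseq_cons /M' size_mkseq take_mkseq//; exact: Mt.
exists (t 0%N) => //; have [_ /(_ w s r rs)[_ ]] := MP (t 0%N); apply.
exists (fun n => t n.+1) => n.
have : M' (mkseq r n.+1) (mkseq t n.+1) w by exact: Mt.
by rewrite [X in M' _ X]mkseq_cons /M' size_mkseq take_mkseq.
Qed.

(** One auxiliary sequence carries a witness for every set of the family, the
[i]-th term of the [j]-th witness being stored at position [pickle (j, i)].  The
pairing is not monotone in [i], so a prefix of the merged sequence does not
correspond to prefixes of the witnesses: at each stage, all the conditions about
prefixes that are already readable are imposed at once. *)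
Lemma coded_souslin_bigcap (A : nat -> set (Omega * S)) :
  (forall j, coded_souslin (A j)) -> coded_souslin (\bigcap_j A j).
Proof.
move=> Asouslin.
have /choice[M MP] j : exists M : seq nat -> seq nat -> set Omega,
    (forall rho tau, measurable (M rho tau)) /\
    forall w s r, (forall k, C k (r k) s) ->
      A j (w, s) <-> exists t, forall n, M (mkseq r n) (mkseq t n) w.
  by have [M mM AM] := Asouslin j; exists M.
pose extracted (j : nat) (tau' tau : seq nat) := forall i, (i < size tau')%N ->
  (pickle (j, i) < size tau)%N /\ nth 0%N tau (pickle (j, i)) = nth 0%N tau' i.
pose M' rho tau := \bigcap_n
  (if @unpickle (nat * seq nat)%type n is Some p then
     [set w | (size p.2 <= size rho)%N -> extracted p.1 p.2 tau ->
       M p.1 (take (size p.2) rho) p.2 w] else setT).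
exists M'.
  move=> rho tau; apply: bigcapT_measurable => n.
  case: unpickle => // -[j tau'] /=.
  have [H|nH] := pselect ((size tau' <= size rho)%N /\ extracted j tau' tau).
    rewrite (_ : [set _ | _] = M j (take (size tau') rho) tau').
      by have [+ _] := MP j; exact.
    by apply/seteqP; split=> w /=; [apply; case: H|].
  rewrite (_ : [set _ | _] = setT) //.
  by apply/seteqP; split=> w //= _ H1 H2; exfalso; exact: nH.
move=> w s r rs; split=> [Aw|[t Mt] j _].
  have /choice[t tP] j : exists t, forall n, M j (mkseq r n) (mkseq t n) w.
    by have [_ /(_ w s r rs)[+ _]] := MP j; apply; exact: Aw.
  pose merged n := if @unpickle (nat * nat)%type n is Some p
    then t p.1 p.2 else 0%N.
  exists merged => n m _; case: unpickle => // -[j tau'] /=.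
  rewrite size_mkseq => le_n ex; rewrite take_mkseq//.
  suff -> : tau' = mkseq (t j) (size tau') by rewrite size_mkseq; exact: tP.
  apply: (@eq_from_nth _ 0%N); first by rewrite size_mkseq.
  move=> i i_lt; have [+ <-] := ex i i_lt; rewrite size_mkseq => p_lt.
  by rewrite !nth_mkseq// /merged pickleK.
have [_ /(_ w s r rs)[_]] := MP j; apply.
exists (fun i => t (pickle (j, i))) => m.
(* Long enough to contain the first [m] stored terms of the [j]-th witness. *)
pose n := (m + \sum_(i < m) (pickle (j, nat_of_ord i)).+1)%N.
have mn : (m <= n)%N by exact: leq_addr.
have pn i : (i < m)%N -> (pickle (j, i) < n)%N.
  move=> im; apply: leq_trans (leq_addl _ _).
  by rewrite (bigD1 (Ordinal im))//= leq_addr.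
have := Mt n (pickle (j, mkseq (fun i => t (pickle (j, i))) m)) I.
rewrite pickleK /= !size_mkseq take_mkseq//; apply=> //.
move=> i; rewrite !size_mkseq => im; split; first exact: pn.
by rewrite !nth_mkseq// pn.
Qed.

Lemma coded_souslin_domain (B : set Omega) : measurable B ->
  coded_souslin [set z | B z.1].
Proof.
move=> mB; exists (fun _ _ => B) => // w s r _; split=> [Bw|[t /(_ 0%N)//]].
by exists (fun=> 0%N).
Qed.

(** Analytic sets are not closed under complement, so the sigma-algebra is that
of the sets that are analytic along with their complement, as in Souslin's
theorem. *)
Definition bicoded (A : set (Omega * S)) : Prop :=
  coded_souslin A /\ coded_souslin (~` A).

Lemma bicoded_sigma_algebra : sigma_algebra setT bicoded.
Proof.
split.
- split; first exact: (@coded_souslin_domain set0).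
  by rewrite setC0; exact: (@coded_souslin_domain setT).
- by move=> A [A1 A2]; rewrite setTD; split; rewrite ?setCK.
- move=> A bA; split.
    by apply: coded_souslin_bigcup => j; case: (bA j).
  by rewrite setC_bigcup; apply: coded_souslin_bigcap => j; case: (bA j).
Qed.

Hypothesis coverC : complete_cover C.

(** By [complete_cover_shrink], a coded point is in [U] iff some finite prefix
of its code already forces membership in [U].  This is an open condition on the
code, so both it and its negation have the required form; for the former, the
auxiliary sequence guesses the length of the prefix. *)
Lemma bicoded_open (U : set S) : open U -> bicoded [set z | U z.2].
Proof.
move=> oU.
pose small rho := [set s | forall k, (k < size rho)%N -> C k (nth 0%N rho k) s]
  `<=` U.
have smallP r n : small (mkseq r n) <->
    forall s, (forall k, (k < n)%N -> C k (r k) s) -> U s.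
  rewrite /small size_mkseq; split=> H s Hs; apply: H => k kn.
    by rewrite nth_mkseq//; exact: Hs.
  by have := Hs k kn; rewrite nth_mkseq.
split.
- exists (fun rho tau => [set _ | (0 < size tau)%N ->
      (head 0%N tau <= size rho)%N -> small (take (head 0%N tau) rho)]).
    by move=> *; exact: measurable_constant_prop.
  move=> w s r rs; split=> [/= Us|[t Ht]].
    have [n nU] := complete_cover_shrink coverC _ _ _ rs oU Us.
    exists (fun=> n) => -[//|m] _.
    rewrite (_ : head _ _ = n)// size_mkseq => nm.
    by rewrite take_mkseq//; exact/smallP.
  have := Ht (t 0%N).+1; rewrite !size_mkseq (_ : head _ _ = t 0%N)//.
  by rewrite take_mkseq ?leqnSn// => /(_ isT isT)/smallP; apply => k _.
- exists (fun rho _ => [set _ | ~ small rho]).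
    by move=> *; exact: measurable_constant_prop.
  move=> w s r rs; split=> [/= nUs|[t Ht] /= Us].
    by exists (fun=> 0%N) => n /smallP nU; apply/nUs/nU.
  have [n nU] := complete_cover_shrink coverC _ _ _ rs oU Us.
  by apply: (Ht n); exact/smallP.
Qed.

End coded_Souslin.

Section projection.
Context {d : measure_display} {Omega : measurableType d} {R : realType}.
Variable P : probability Omega R.
Hypothesis completeP : measure_is_complete P.

(** A code and an auxiliary sequence are merged into one sequence of pairs.
Requiring the finite intersections along the code to be nonempty replaces the
existence of the point coded, by [complete_cover_inhabited], so that the
projection becomes a Souslin operation on subsets of [Omega]. *)
Lemma coded_souslin_projection {S : topologicalType} (C : nat -> nat -> set S)
    (A : set (Omega * S)) : complete_cover C -> coded_souslin C A ->
  measurable [set w | exists s, A (w, s)].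
Proof.
move=> coverC [M mM AM].
pose box rho := [set s | forall k, (k < size rho)%N -> C k (nth 0%N rho k) s].
pose N (z : seq (nat * nat)) :=
  M (map fst z) (map snd z) `&` [set _ | box (map fst z) !=set0].
rewrite (_ : [set _ | _] =
    [set w | exists q : nat -> nat * nat, forall n, N (mkseq q n) w]).
  apply: (souslin_measurable _ completeP) => z; apply: measurableI => //.
  exact: measurable_constant_prop.
apply/seteqP; split=> w /=.
  move=> [s Aws]; have /choice[r rs] := complete_cover_total coverC s.
  have [t Mt] := (AM w s r rs).1 Aws.
  exists (fun n => (r n, t n)) => n; rewrite /N /mkseq -!map_comp; split.
    exact: Mt.
  exists s => k; rewrite size_map size_iota => kn.
  by rewrite (nth_map 0%N) ?size_iota// nth_iota//=.
move=> [q Nq].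
have [s qs] : exists s, forall k, C k (q k).1 s.
  apply: (complete_cover_inhabited coverC) => n.
  have [_ [s sP]] := Nq n; exists s => k kn; have := sP k.
  rewrite -map_comp size_map size_iota => /(_ kn).
  by rewrite (nth_map 0%N) ?size_iota// nth_iota.
exists s; apply/(AM w s _ qs); exists (fun n => (q n).2) => n.
by have [+ _] := Nq n; rewrite /mkseq -!map_comp.
Qed.

(** The graph is bicoded, since both kinds of generators of the product
sigma-algebra are: the cylinders over measurable subsets of [Omega] and, by a
second generation argument, the cylinders over Borel subsets of [S]. *)
Lemma measurable_projection {S : ptopologicalType} (C : nat -> nat -> set S)
    (X : Omega -> set S) : complete_cover C -> graph_measurable X ->
  measurable [set w | X w !=set0].
Proof.
move=> coverC gX.
apply: (coded_souslin_projection _ [set z | X z.1 z.2] coverC).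
suff : bicoded C [set z : Omega * S | X z.1 z.2] by case.
move: gX; apply: smallest_sub; first exact: bicoded_sigma_algebra.
move=> _ [] [B mB <-]; rewrite setTI.
  split; first exact: coded_souslin_domain.
  exact: (coded_souslin_domain _ _ (measurableC mB)).
pose G := [set B : set S | bicoded C [set z : Omega * S | B z.2]].
suff : G B by [].
have [G0 GC GU] := @bicoded_sigma_algebra _ Omega _ C.
move: mB; apply: smallest_sub; last by move=> U; exact: bicoded_open.
split; first exact: G0.
  by move=> A GA; rewrite setTD; have := GC _ GA; rewrite setTD.
by move=> F GF; exact: (GU (fun n => [set z : Omega * S | F n z.2])).
Qed.

End projection.

(** * Elementary properties of the weak-* dual *)

Section dual_pairing.
Context {R : realType} {V : normedModType R}.

Fact dual_is_linear (u : dual_space V) : linear u.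
Proof. by have /asboolP[] := dual_funP u. Qed.

HB.instance Definition _ (u : dual_space V) :=
  GRing.isLinear.Build R V R^o *:%R u (dual_is_linear u).

Lemma dual_continuous (u : dual_space V) : continuous u.
Proof. by have /asboolP[] := dual_funP u. Qed.

Lemma dual_bounded (u : dual_space V) :
  exists m : nat, forall x, `|u x| <= m%:R * `|x|.
Proof.
have /linear_bounded_continuous/linear_boundedP/pinfty_ex_gt0[c c0 uc] :=
  @dual_continuous u.
exists (Num.bound c) => x; apply: (le_trans (uc x)).
by rewrite ler_wpM2r// ltW// archi_boundP// ltW.
Qed.

Lemma dual_of_bounded (f : V -> R) (m : R) :
  linear (f : V -> R^o) ->
  (forall x, `|f x| <= m * `|x|) ->
  exists u : dual_space V, forall x, u x = f x.
Proof.
move=> f_lin fm.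
pose g : {linear V -> R^o} :=
  HB.pack (f : V -> R^o) (GRing.isLinear.Build _ _ _ _ _ f_lin).
suff fP : (f : V -> R^o) \in @continuous_linear R V by exists (DualSpace fP).
apply/asboolP; split=> //.
apply: (@bounded_linear_continuous _ _ _ g); apply/linear_boundedP.
near=> r => x; apply: (le_trans (fm x)); rewrite ler_wpM2r//.
Unshelve. all: by end_near. Qed.

Lemma cvg_dual (F : set_system (dual_space V)) {FF : Filter F}
    (u : dual_space V) :
  (forall x, (fun v : dual_space V => v x) @ F --> u x) -> F --> u.
Proof.
move=> Fu A [_ [[B oB <-] Bu] BA].
have /pointwise_cvgP cF : forall x : V,
    (fun g : {ptws V -> R^o} => g x) @
      ((@dual_fun R V : _ -> {ptws V -> R^o}) @ F) --> (u : {ptws V -> R^o}) x by exact: Fu.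
rewrite /= nbhs_simpl; apply: (filterS BA).
apply: (cF B); exact: open_nbhs_nbhs.
Qed.

Lemma dual_eval_continuous (x : V) :
  continuous (fun u : dual_space V => u x : R^o).
Proof.
move=> u.
have /pointwise_cvgP : {ptws,
    ((@dual_fun R V : dual_space V -> {ptws V -> R^o}) @ nbhs u) -->
    (u : {ptws V -> R^o})}.
  exact: (@initial_continuous (dual_space V) {ptws V -> R^o} (@dual_fun R V)).
exact.
Qed.

End dual_pairing.

(** * Complete covers of a Banach space and of its weak-* dual *)

Section covers.
Context {R : realType}.

Lemma separable_dense_sequence {V : normedModType R} : separable V ->
  exists c : nat -> V, forall x e, 0 < e -> exists n, `|x - c n| < e.
Proof.
move=> [D /countable_injP[f finj] dD].
exists (fun n => xget 0 [set y | D y /\ f y = n]) => x e e0.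
have [y [xy Dy]] : ball x e `&` D !=set0.
  by apply: dD; [exists x; exact: ballxx|exact: ball_open].
exists (f y).
have [Dz fz] := @xgetPex _ 0 [set z | D z /\ f z = f y]
  (ex_intro _ y (conj Dy erefl)).
by rewrite (finj _ _ _ _ fz) ?inE//; move: xy; rewrite -ball_normE.
Qed.

Lemma norm_limit_le {V : normedModType R} (u : nat -> V) (l q : V)
    (c : R) (k : nat) :
  u @ \oo --> l -> (forall n, (k < n)%N -> `|u n - q| <= c) -> `|l - q| <= c.
Proof.
move=> ul uc; apply/ler_addgt0Pr => e e0.
have /cvgrPdist_lt/(_ e e0) lu := ul.
near \oo => n.
have -> : l - q = (l - u n) + (u n - q) by rewrite addrA subrK.
rewrite (le_trans (ler_normD _ _))// addrC lerD//.
  by apply: uc; near: n; exact: nbhs_infty_gt.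
by apply: ltW; near: n.
Unshelve. all: by end_near. Qed.

(** The centres [q] may vary with [e] and need not be terms of the sequence,
which is the form of the Cauchy criterion supplied by the codes. *)
Lemma cvg_of_approximations {V : completeNormedModType R} (u : nat -> V) :
  (forall e, 0 < e -> exists q k, forall n, (k < n)%N -> `|u n - q| <= e) ->
  exists l : V, u @ \oo --> l.
Proof.
move=> H; apply: (@cvg_ex _ (u @ \oo)).1.
apply/cauchy_cvgP/cauchy_exP => e e0.
have [q [k uq]] := H _ (ltac:(by rewrite divr_gt0) : 0 < e / 2).
exists q; exists k.+1 => // n /= kn; rewrite -ball_normE /= distrC.
by apply: (le_lt_trans (uq n kn)); rewrite ltr_pdivrMr// ltr_pMr// ltr1n.
Qed.

Lemma exists_invS_lt (e : R) : 0 < e -> exists n, n.+1%:R^-1 < e.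
Proof.
move=> e0; have [n _ /(_ n (leqnn n)) ne] := near_infty_natSinv_lt (PosNum e0).
by exists n.
Qed.

Lemma invS_gt0 (n : nat) : 0 < n.+1%:R^-1 :> R.
Proof. by rewrite invr_gt0 ltr0n. Qed.

(** Closed balls centred at a dense sequence, of radius [1/(k+1)] at level [k]:
a code with nonempty finite intersections yields a Cauchy sequence. *)
Lemma Banach_complete_cover {V : completeNormedModType R} : separable V ->
  exists C : nat -> nat -> set V, complete_cover C.
Proof.
move=> /separable_dense_sequence[c cd].
exists (fun k i => [set s | `|s - c i| <= k.+1%:R^-1]); split.
- by move=> s k; have [n /ltW ?] := cd s _ (invS_gt0 k); exists n.
- move=> r /choice[s sP].
  have sC n k : (k < n)%N -> `|s n - c (r k)| <= k.+1%:R^-1 by exact: sP.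
  have [l sl] : exists l : V, s @ \oo --> l.
    apply: cvg_of_approximations => e /exists_invS_lt[k ke].
    by exists (c (r k)), k => n /sC/le_trans; apply; exact: ltW.
  by exists l => k; apply: (norm_limit_le s _ _ _ k sl) => n; exact: sC.
- move=> r s U rs oU Us.
  have /nbhs_normP[e /= e0 eU] : nbhs s U by exact: open_nbhs_nbhs.
  have [n ne] := exists_invS_lt (e / 2) (ltac:(by rewrite divr_gt0)).
  exists n.+1 => s' /(_ n (ltnSn n)) s'n; apply: eU => /=.
  have -> : s - s' = (s - c (r n)) - (s' - c (r n)) by rewrite opprB addrA subrK.
  rewrite (le_lt_trans (ler_normB _ _))// (le_lt_trans (lerD (rs n) s'n))//.
  by rewrite [ltRHS]splitr ltrD.
Qed.

Section dual_cover.
Variable V : normedModType R.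
Variable c : nat -> V.
Hypothesis cd : forall x e, 0 < e -> exists n, `|x - c n| < e.

(** Level [k] stands for a pair [(a, b)] and index [i] for a norm bound [m] and
rationals [q], [q'] approximating, to within [1/(b+1)], the value at [c a] and
the real coordinate.  Levels that encode no pair carry no information, and
indices that encode no approximation give the empty set. *)
Definition dual_cover (k i : nat) : set (dual_space V * R^o) :=
  if @unpickle (nat * nat)%type k is Some (a, b) then
    if @unpickle (nat * (rat * rat))%type i is Some (m, (q, q')) then
      [set z : dual_space V * R^o | [/\ forall x, `|z.1 x| <= m%:R * `|x|,
        `|z.1 (c a) - ratr q| <= b.+1%:R^-1 & `|z.2 - ratr q'| <= b.+1%:R^-1]]
    else set0
  else setT.

Lemma ratr_approx (x e : R) : 0 < e -> exists q : rat, `|x - ratr q| <= e.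
Proof.
move=> e0; have [|q qP] := @rat_in_itvoo R (x - e) (x + e).
  by rewrite ltrD2l gtrN.
move: qP; rewrite in_itv /= => /andP[q1 q2].
exists q; rewrite distrC ler_norml lerBlDl (ltW q2) andbT lerNl opprB lerBlDl.
by rewrite -lerBlDr; exact: ltW.
Qed.

(** The witnesses do not depend on [z].  If [i] encodes nothing, the cover set
is empty and any witnesses will do. *)
Lemma dual_cover_pickle (a b i : nat) : exists (m : nat) (q q' : rat),
  forall z, dual_cover (pickle (a, b)) i z ->
    [/\ forall x, `|z.1 x| <= m%:R * `|x|,
      `|z.1 (c a) - ratr q| <= b.+1%:R^-1 & `|z.2 - ratr q'| <= b.+1%:R^-1].
Proof.
rewrite /dual_cover pickleK.
case: unpickle => [[m [q q']]|]; last by exists 0%N, 0, 0.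
by exists m, q, q'.
Qed.

(** A finite part of a code determines the value at an arbitrary vector [x] up
to [e]: it contains a norm bound, a point [c a] close to [x] relatively to this
bound, and an approximation of the value at [c a]. *)
Lemma dual_cover_fst (r : nat -> nat) (x : V) (e : R) : 0 < e ->
  exists (q : R) n, forall z : dual_space V * R^o,
    (forall k, (k < n)%N -> dual_cover k (r k) z) ->
    `|z.1 x - q| <= e.
Proof.
move=> e0.
have [m [? [? mP]]] := dual_cover_pickle 0 0 (r (pickle (0, 0)%N)).
have e2 : 0 < e / 2 by rewrite divr_gt0.
have [a xa] := cd x (e / 2 / m.+1%:R) (ltac:(by rewrite divr_gt0)).
have [b be] := exists_invS_lt _ e2.
have [? [q [? qP]]] := dual_cover_pickle a b (r (pickle (a, b))).
exists (ratr q), (maxn (pickle (0, 0)%N) (pickle (a, b))).+1 => z zP.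
have /mP[zm _ _] : dual_cover (pickle (0, 0)%N) (r (pickle (0, 0)%N)) z.
  by apply: zP; rewrite ltnS leq_maxl.
have /qP[_ zq _] : dual_cover (pickle (a, b)) (r (pickle (a, b))) z.
  by apply: zP; rewrite ltnS leq_maxr.
have -> : z.1 x - ratr q = z.1 (x - c a) + (z.1 (c a) - ratr q).
  by rewrite linearB addrA subrK.
rewrite (le_trans (ler_normD _ _))// [leRHS]splitr lerD//; last first.
  by rewrite (le_trans zq)// ltW.
rewrite (le_trans (zm _))// (@le_trans _ _ (m.+1%:R * `|x - c a|))//.
  by rewrite ler_wpM2r// ler_nat.
by rewrite mulrC -ler_pdivlMr// ltW.
Qed.

Lemma dual_cover_snd (r : nat -> nat) (e : R) : 0 < e ->
  exists (q : R) n, forall z : dual_space V * R^o,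
    (forall k, (k < n)%N -> dual_cover k (r k) z) ->
    `|z.2 - q| <= e.
Proof.
move=> /exists_invS_lt[b /ltW be].
have [? [? [q qP]]] := dual_cover_pickle 0 b (r (pickle (0%N, b))).
exists (ratr q), (pickle (0%N, b)).+1 => z zP.
by have [_ _ zq] := qP z (zP _ (ltnSn _)); exact: le_trans be.
Qed.

(** Functionals taken from longer and longer finite intersections of a code
converge pointwise, by [dual_cover_fst], to a linear functional obeying the same
norm bound, hence continuous.  For the neighbourhoods, if the finite
intersections all left the open set [U], points chosen in them outside [U] would
converge to the coded point, which is in [U]. *)
Lemma weak_dual_complete_cover : complete_cover dual_cover.
Proof.
split.
- move=> z k; rewrite /dual_cover.
  case: (unpickle k) => [[a b]|]; last by exists 0%N.
  have [m mP] := dual_bounded z.1.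
  have [q qP] := ratr_approx (z.1 (c a)) _ (invS_gt0 b).
  have [q' q'P] := ratr_approx z.2 _ (invS_gt0 b).
  by exists (pickle (m, (q, q'))); rewrite pickleK.
- move=> r /choice[z zP].
  have /choice[l zl] x : exists l : R^o, (fun n => (z n).1 x) @ \oo --> l.
    apply: cvg_of_approximations => e e0.
    have [q [n nq]] := dual_cover_fst r x e e0.
    exists q, n => p np; apply: nq => k kn; apply: zP; exact: ltn_trans np.
  have [t zt] : exists t : R^o, (fun n => (z n).2) @ \oo --> t.
    apply: cvg_of_approximations => e e0.
    have [q [n nq]] := dual_cover_snd r e e0.
    exists q, n => p np; apply: nq => k kn; apply: zP; exact: ltn_trans np.
  have l_lin : linear (l : V -> R^o).
    move=> a x y; apply: (cvg_unique (@Rhausdorff R) (zl _)).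
    have -> : (fun n => (z n).1 (a *: x + y)) =
        fun n => a *: ((z n).1 x : R^o) + (z n).1 y.
      by apply/funext => n; rewrite linearP.
    by apply: cvgD; [apply: cvgZl_tmp|]; exact: zl.
  have [m [? [? mP]]] := dual_cover_pickle 0 0 (r (pickle (0, 0)%N)).
  have [x|u ul] := dual_of_bounded l m%:R l_lin.
    rewrite -[X in `|X|]subr0; apply: (norm_limit_le _ _ _ _ _ (zl x)) => n kn.
    by rewrite subr0; have [+ _ _] := mP _ (zP n _ kn); exact.
  exists (u, t) => k; have := zP k.+1 k (ltnSn k).
  have : forall n, (k < n)%N -> dual_cover k (r k) (z n) by move=> n; exact: zP.
  rewrite /dual_cover; case: (unpickle k) => [[a b]|//].
  case: unpickle => [[m' [q q']]|//] zk _; split=> [x||] /=.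
  + rewrite ul -[X in `|X|]subr0; apply: (norm_limit_le _ _ _ _ _ (zl x)) => n kn.
    by rewrite subr0; have [+ _ _] := zk n kn; exact.
  + rewrite ul; apply: (norm_limit_le _ _ _ _ _ (zl (c a))) => n kn.
    by have [] := zk n kn.
  + by apply: (norm_limit_le _ _ _ _ _ zt) => n kn; have [] := zk n kn.
- move=> r [u t] U rs oU Us; apply: contrapT => /forallNP H.
  have /choice[z zP] n : exists z,
      (forall k, (k < n)%N -> dual_cover k (r k) z) /\ ~ U z.
    by have /existsNP[z /not_implyP zP] := H n; exists z.
  have z1 : (fun n => (z n).1) @ \oo --> u.
    apply: cvg_dual => x; apply/cvgrPdist_le => e e0.
    have [q [n nq]] := dual_cover_fst r x _
      (ltac:(by rewrite divr_gt0) : 0 < e / 2).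
    have uq := nq (u, t) (fun k _ => rs k).
    near_simpl; near=> p.
    have -> : u x - (z p).1 x = (u x - q) - ((z p).1 x - q)
      by rewrite opprB addrA subrK.
    rewrite (le_trans (ler_normB _ _))// [leRHS]splitr lerD//.
    apply: nq => k kn; apply: (zP p).1; apply: (leq_trans kn).
    by near: p; exact: nbhs_infty_ge.
  have z2 : (fun n => (z n).2 : R^o) @ \oo --> (t : R^o).
    apply/cvgrPdist_le => e e0.
    have [q [n nq]] := dual_cover_snd r _
      (ltac:(by rewrite divr_gt0) : 0 < e / 2).
    have uq := nq (u, t) (fun k _ => rs k).
    near_simpl; near=> p.
    have -> : t - (z p).2 = (t - q) - ((z p).2 - q)
      by rewrite opprB addrA subrK.
    rewrite (le_trans (ler_normB _ _))// [leRHS]splitr lerD//.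
    apply: nq => k kn; apply: (zP p).1; apply: (leq_trans kn).
    by near: p; exact: nbhs_infty_ge.
  have [n _ /(_ n (leqnn n))/=] := cvg_pair z1 z2 (open_nbhs_nbhs (conj oU Us)).
  by rewrite -surjective_pairing; apply: (zP n).2.
Unshelve. all: by end_near. Qed.

End dual_cover.
End covers.

(** * Sublinear functionals and the Mazur-Orlicz theorem *)

Section Mazur_Orlicz.
Context {R : realType} {V : lmodType R}.

(** Homogeneity is required as an inequality, which is easier to check on
infima; the equality follows by scaling back. *)
Record sublinear (p : V -> R) : Prop := Sublinear {
  sublinearD : forall x y, p (x + y) <= p x + p y;
  sublinearZ : forall a x, 0 < a -> p (a *: x) <= a * p x }.
Arguments sublinearD {p}.
Arguments sublinearZ {p}.

Lemma sublinearZ_eq (p : V -> R) a x : sublinear p -> 0 < a ->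
  p (a *: x) = a * p x.
Proof.
move=> sp a0; apply/eqP; rewrite eq_le (sublinearZ sp)//=.
rewrite mulrC -ler_pdivlMr// mulrC.
have := sublinearZ sp a^-1 (a *: x).
by rewrite scalerA mulVf ?gt_eqF// scale1r invr_gt0; apply.
Qed.

Lemma sublinear0 (p : V -> R) : sublinear p -> p 0 = 0.
Proof.
move=> sp; have := sublinearZ_eq p 2 0 sp (ltr0n R 2).
by rewrite scaler0; lra.
Qed.

Lemma sublinear_opp (p : V -> R) x : sublinear p -> - p (- x) <= p x.
Proof.
move=> sp; have := sublinearD sp x (- x).
by rewrite subrr sublinear0// -lerBlDr sub0r.
Qed.

(** Given a convex cone [K] of constraints [a <= f x], each compatible with [p],
the functional [q x], infimum of [p (x + y) - a] over the constraints [(y, a)],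
is sublinear, and any linear functional below [q] satisfies the constraints.  It
is bounded below by [- p (- x)] thanks to the compatibility of [K] with [p]. *)
Lemma sublinear_strengthen (p : V -> R) (K : V -> R -> Prop) :
  sublinear p -> K 0 0 ->
  (forall x y a b, K x a -> K y b -> K (x + y) (a + b)) ->
  (forall c x a, 0 < c -> K x a -> K (c *: x) (c * a)) ->
  (forall x a, K x a -> a <= p x) ->
  exists q, [/\ sublinear q, forall x, q x <= p x &
    forall x a, K x a -> q (- x) <= - a].
Proof.
move=> sp K0 KD KZ Kp.
pose I x := [set s | exists y a, K y a /\ s = p (x + y) - a].
pose q x := inf (I x).
have I_lb x : lbound (I x) (- p (- x)).
  move=> _ [y [a [Kya ->]]]; rewrite lerBrDr -lerBrDl opprK.
  rewrite (le_trans (Kp _ _ Kya))//.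
  by have := sublinearD sp (x + y) (- x); rewrite addrAC subrr add0r.
have q_le x y a : K y a -> q x <= p (x + y) - a.
  move=> Kya; apply: ge_inf; first by exists (- p (- x)); exact: I_lb.
  by exists y, a.
have le_q x r : (forall y a, K y a -> r <= p (x + y) - a) -> r <= q x.
  move=> H; apply: lb_le_inf; first by exists (p (x + 0) - 0), 0, 0.
  by move=> _ [y [a [Kya ->]]]; exact: H.
exists q; split.
- split=> [x y|c x c0].
    rewrite -lerBlDr; apply: (le_q) => x' a Kx.
    rewrite lerBlDr -lerBlDl; apply: (le_q) => y' b Ky.
    rewrite lerBlDr (le_trans (q_le _ _ _ (KD _ _ _ _ Ky Kx)))//.
    rewrite [X in p X - _](_ : _ = (y + y') + (x + x')).
      by have := sublinearD sp (y + y') (x + x'); lra.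
    by rewrite [x + y]addrC -!addrA; congr (_ + _); rewrite addrCA.
  rewrite mulrC -ler_pdivrMr//; apply: (le_q) => y a Kya.
  rewrite ler_pdivrMr// (le_trans (q_le _ _ _ (KZ _ _ _ c0 Kya)))//.
  by rewrite -scalerDr; have := sublinearZ sp c (x + y) c0; lra.
- by move=> x; have := q_le x 0 0 K0; rewrite addr0 subr0.
- by move=> x a Kxa; have := q_le (- x) x a Kxa; rewrite addNr sublinear0// sub0r.
Qed.

(** For a given [x], imposing the constraints [t * q x <= f (t *: x)] produces a
sublinear functional below [q], which is [q] itself by minimality; this gives
[q (- x) <= - q x], and an odd sublinear functional is linear. *)
Lemma minimal_sublinear_linear (q : V -> R) : sublinear q ->
  (forall q', sublinear q' -> (forall x, q' x <= q x) -> q' = q) ->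
  linear (q : V -> R^o).
Proof.
move=> sq qmin.
have qN x : q (- x) = - q x.
  apply/eqP; rewrite eq_le; apply/andP; split; last first.
    by have := sublinear_opp q (- x) sq; rewrite opprK.
  have [||||q' [sq' q'q q'N]] := @sublinear_strengthen q
      (fun y a => exists t, [/\ 0 <= t, y = t *: x & a = t * q x]) sq.
  - by exists 0; rewrite scale0r mul0r.
  - move=> _ _ _ _ [s [s0 -> ->]] [t [t0 -> ->]]; exists (s + t).
    by rewrite addr_ge0// scalerDl mulrDl.
  - move=> c _ _ c0 [t [t0 -> ->]]; exists (c * t).
    by rewrite mulr_ge0 ?(ltW c0)// scalerA mulrA.
  - move=> _ _ [t [t0 -> ->]].
    move: t0; rewrite le_eqVlt => /orP[/eqP <-|t0].
      by rewrite scale0r mul0r sublinear0.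
    by rewrite sublinearZ_eq.
  - rewrite -(qmin _ sq' q'q); apply: (le_trans (q'N x (q x) _)).
      by exists 1; rewrite scale1r mul1r.
    by rewrite (qmin _ sq' q'q).
have qD x y : q (x + y) = q x + q y.
  apply/eqP; rewrite eq_le (sublinearD sq)//=.
  have := sublinearD sq (x + y) (- y).
  by rewrite addrK qN lerBrDr.
have qZ a x : q (a *: x) = a * q x.
  have [a0|a0|->] := ltgtP a 0.
  - rewrite -[a]opprK scaleNr qN sublinearZ_eq ?oppr_gt0//.
    by rewrite opprK mulNr opprK.
  - by rewrite sublinearZ_eq.
  - by rewrite scale0r mul0r sublinear0.
by move=> a x y; rewrite qD qZ.
Qed.

(** Subadditivity of the infimum uses the chain condition: given two members,
the smaller one serves for both summands. *)
Lemma sublinear_chain_inf (F : set (V -> R)) (p : V -> R) : F !=set0 ->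
  (forall q, F q -> sublinear q /\ forall x, q x <= p x) ->
  (forall q q', F q -> F q' ->
    (forall x, q x <= q' x) \/ (forall x, q' x <= q x)) ->
  exists m, sublinear m /\ forall q, F q -> forall x, m x <= q x.
Proof.
move=> [q0 Fq0] Fp Ftot.
pose m x := inf [set q x | q in F].
have m_le q x : F q -> m x <= q x.
  move=> Fq; apply: ge_inf; last by exists q.
  exists (- p (- x)) => _ [q' /Fp[sq' q'p] <-].
  by apply: le_trans (sublinear_opp q' x sq'); rewrite lerN2.
have le_m x r : (forall q, F q -> r <= q x) -> r <= m x.
  move=> H; apply: lb_le_inf; first by exists (q0 x), q0.
  by move=> _ [q Fq <-]; exact: H.
exists m; split=> [|q Fq x]; last exact: m_le.
split=> [x y|c x c0].
  rewrite -lerBlDr; apply: (le_m) => q Fq.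
  rewrite lerBlDr -lerBlDl; apply: (le_m) => q' Fq'.
  rewrite lerBlDl; have [qq'|q'q] := Ftot _ _ Fq Fq'.
    rewrite (le_trans (m_le q _ Fq))// (le_trans (sublinearD (Fp q Fq).1 _ _))//.
    by rewrite lerD2l.
  rewrite (le_trans (m_le q' _ Fq'))// (le_trans (sublinearD (Fp q' Fq').1 _ _))//.
  by rewrite lerD2r.
rewrite mulrC -ler_pdivrMr//; apply: (le_m) => q Fq.
rewrite ler_pdivrMr// mulrC (le_trans (m_le q _ Fq))//.
exact: (sublinearZ (Fp q Fq).1).
Qed.

(** The linear functional is a minimal sublinear functional below [p], given by
Zorn's lemma for the reversed pointwise order. *)
Lemma sublinear_dominates_linear (p : V -> R) : sublinear p ->
  exists f : V -> R, linear (f : V -> R^o) /\ forall x, f x <= p x.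
Proof.
move=> sp.
pose T := {q : V -> R | sublinear q /\ forall x, q x <= p x}.
pose le (s t : T) := `[< forall x, sval t x <= sval s x >].
have [| | |F Ftot|[q [sq qp]] qmax] := @Zorn T le.
- by move=> t; apply/asboolP.
- move=> r s t /asboolP rs /asboolP st; apply/asboolP => x.
  exact: le_trans (st x) (rs x).
- move=> [s sP] [t tP] /asboolP/= st /asboolP/= ts; apply: eq_exist.
  by apply/funext => x; apply/eqP; rewrite eq_le st ts.
- have [[t0 Ft0]|F0] := pselect (F !=set0); last first.
    exists (exist _ p (conj sp (fun x => lexx _))) => s Fs.
    by exfalso; apply: F0; exists s.
  have [|||m [sm mF]] := @sublinear_chain_inf [set sval t | t in F] p.
  + by exists (sval t0), t0.
  + by move=> _ [t _ <-]; exact: (svalP t).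
  + move=> _ _ [s Fs <-] [t Ft <-].
    by have [/asboolP|/asboolP] := Ftot s t Fs Ft; [right|left].
  + have mp x : m x <= p x.
      apply: (le_trans (mF (sval t0) _ x)); first by exists t0.
      exact: (svalP t0).2.
    exists (exist _ m (conj sm mp)) => s Fs; apply/asboolP => x /=.
    by apply: mF; exists s.
- exists q; split=> //; apply: minimal_sublinear_linear => // q' sq' q'q.
  have q'p x : q' x <= p x by exact: le_trans (q'q x) (qp x).
  have le_q' : le (exist _ q (conj sq qp)) (exist _ q' (conj sq' q'p)).
    exact/asboolP.
  exact: (congr1 sval (qmax _ le_q')).
Qed.

(** A cone of lower bounds, each dominated by [p], can be imposed on a linear
functional dominated by [p]. *)
Lemma Mazur_Orlicz (p : V -> R) (K : V -> R -> Prop) :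
  sublinear p -> K 0 0 ->
  (forall x y a b, K x a -> K y b -> K (x + y) (a + b)) ->
  (forall c x a, 0 < c -> K x a -> K (c *: x) (c * a)) ->
  (forall x a, K x a -> a <= p x) ->
  exists f : V -> R, [/\ linear (f : V -> R^o), forall x, f x <= p x &
    forall x a, K x a -> a <= f x].
Proof.
move=> sp K0 KD KZ Kp.
have [q [sq qp qK]] := sublinear_strengthen p K sp K0 KD KZ Kp.
have [f [f_lin fq]] := sublinear_dominates_linear q sq.
exists f; split=> // [x|x a Kxa]; first exact: le_trans (fq x) (qp x).
have fN : f (- x) = - f x.
  pose g : {linear V -> R^o} :=
    HB.pack (f : V -> R^o) (GRing.isLinear.Build _ _ _ _ _ f_lin).
  exact: (linearN g x).
by rewrite -lerN2 -fN (le_trans (fq _))// qK.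
Qed.

End Mazur_Orlicz.

(** * Separation, epigraphs of support functions and level boxes *)

Section duality.
Context {R : realType} {V : normedModType R}.

Lemma convex_setP (M : lmodType R) (A : set M) (x y : M) (a b : R) :
  convex_set A -> A x -> A y -> 0 <= a -> 0 <= b -> a + b = 1 ->
  A (a *: x + b *: y).
Proof.
move=> cA Ax Ay a0 b0 ab.
have a1 : a <= 1 by rewrite -ab lerDl.
have := cA x y (Itv01 a0 a1); rewrite !inE => /(_ Ax Ay).
by rewrite (_ : b = 1 - a) // -ab addrAC subrr add0r.
Qed.

(** Let [e > 0] be a lower bound for the distance from [x] to [A].  The
constraints [l * e <= f (l *: (x - a))], for [l >= 0] and [a] in [A], are
dominated by the norm and form a cone because [A] is convex, so the Mazur-Orlicz
theorem applies directly, without gauge functionals.  The empty set is separated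
by the zero functional and the level [-1]. *)
Lemma convex_closed_separation (A : set V) (x : V) :
  closed A -> convex_set A -> ~ A x ->
  exists (u : dual_space V) (t : R), (forall a, A a -> u a <= t) /\ t < u x.
Proof.
move=> clA cA nAx.
have [[a0 Aa0]|A0] := pselect (A !=set0); last first.
  exists 0, (-1); split; last by rewrite ltrN10.
  by move=> a Aa; exfalso; apply: A0; exists a.
have /nbhs_normP[e /= e0 eA] : nbhs x (~` A).
  by apply: open_nbhs_nbhs; split => //; exact: closed_openC.
have dist_le a : A a -> e <= `|x - a|.
  by move=> Aa; rewrite leNgt; apply/negP => /eA; exact.
have norm_sublinear : sublinear (fun v : V => `|v|).
  by split=> [v w|c v c0]; rewrite ?ler_normD// normrZ gtr0_norm.
pose K (v : V) (r : R) :=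
  exists l a, [/\ 0 <= l, A a, v = l *: (x - a) & r = l * e].
have [||||f [f_lin f_le fK]] := Mazur_Orlicz _ K norm_sublinear.
- by exists 0, a0; rewrite scale0r mul0r.
- move=> _ _ _ _ [l [a [l0 Aa -> ->]]] [m [b [m0 Ab -> ->]]].
  have [lm0|lm0] := eqVneq (l + m) 0.
    exists 0, a0; rewrite scale0r mul0r.
    have -> : l = 0 by lra.
    have -> : m = 0 by lra.
    by rewrite !scale0r !mul0r !addr0.
  exists (l + m), ((l / (l + m)) *: a + (m / (l + m)) *: b).
  have lm : 0 <= l + m by exact: addr_ge0.
  split=> //; [|..|by rewrite mulrDl].
    apply: convex_setP => //; [exact: divr_ge0|exact: divr_ge0|].
    by rewrite -mulrDl divff.
  rewrite [RHS]scalerBr [in RHS]scalerDr !scalerA ![(l + m) * _]mulrC !divfK//.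
  by rewrite !scalerBr [in RHS]scalerDl opprD addrACA.
- move=> c _ _ c0 [l [a [l0 Aa -> ->]]]; exists (c * l), a.
  by rewrite mulr_ge0 ?(ltW c0)// scalerA mulrA.
- move=> _ _ [l [a [l0 Aa -> ->]]].
  by rewrite normrZ ger0_norm// ler_wpM2l// dist_le.
have [v|u uf] := dual_of_bounded f 1 f_lin.
  rewrite mul1r ler_norml f_le andbT lerNl.
  pose g : {linear V -> R^o} :=
    HB.pack (f : V -> R^o) (GRing.isLinear.Build _ _ _ _ _ f_lin).
  by rewrite -[- f v](linearN g v) -[leRHS]normrN f_le.
exists u, (u x - e); split; last by rewrite gtrBl.
move=> a Aa; rewrite lerBrDl -lerBrDr.
have -> : u x - u a = f (x - a) by rewrite -uf linearB.
apply: fK.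
by exists 1, a; rewrite scale1r mul1r.
Qed.

Lemma epi_support_functionE (A : set V) :
  epi (support_function A) =
    \bigcap_(x in A) [set z : dual_space V * R^o | z.1 x <= z.2].
Proof.
apply/seteqP; split=> -[u t]; rewrite /epi /support_function /= => H.
  move=> x Ax /=; rewrite -lee_fin; apply: le_trans H.
  by apply: ereal_sup_ubound; exists x.
by apply: ge_ereal_sup => _ [x Ax <-]; rewrite lee_fin; exact: H.
Qed.

Lemma dual_eval_pair_continuous (x : V) :
  continuous (fun z : dual_space V * R^o => z.1 x - z.2 : R^o).
Proof.
move=> z.
apply: (@cvgB _ R^o _ (nbhs z) _ (fun z => z.1 x) snd (z.1 x) z.2).
  apply: (@cvg_comp _ _ _ fst (fun u : dual_space V => u x : R^o)
    (nbhs z) (nbhs z.1)); [exact: cvg_fst|exact: dual_eval_continuous].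
exact: cvg_snd.
Qed.

Lemma closed_dual_le (x : V) (e : R) :
  closed [set z : dual_space V * R^o | z.2 + e <= z.1 x].
Proof.
rewrite (_ : [set _ | _] =
    (fun z : dual_space V * R^o => z.1 x - z.2 : R^o) @^-1` [set r | e <= r]).
  apply: (continuous_closedP _).1; first exact: dual_eval_pair_continuous.
  exact: closed_ge.
by apply/seteqP; split=> z /=; rewrite lerBrDl.
Qed.

Lemma closed_dual_ge (x : V) :
  closed [set z : dual_space V * R^o | z.1 x <= z.2].
Proof.
rewrite (_ : [set _ | _] =
    (fun z : dual_space V * R^o => z.1 x - z.2 : R^o) @^-1` [set r | r <= 0]).
  apply: (continuous_closedP _).1; first exact: dual_eval_pair_continuous.
  exact: closed_le.
by apply/seteqP; split=> z /=; rewrite subr_le0.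
Qed.

(** By [epi_support_functionE] the epigraph is an intersection of closed
half-spaces through the origin, each of them stable under increase of the real
coordinate. *)
Lemma epi_support_function_family (A : set V) :
  epi_family (epi (support_function A)).
Proof.
rewrite epi_support_functionE; split.
- by apply: closed_bigI => x _; exact: closed_dual_ge.
- move=> z z' l; rewrite !inE => zA z'A x Ax.
  have h := zA x Ax; have h' := z'A x Ax.
  change (l%:num * z.1 x + (1 - l%:num) * z'.1 x <=
    l%:num * z.2 + (1 - l%:num) * z'.2).
  by rewrite lerD// ler_wpM2l// subr_ge0 le1.
- by move=> a z a0 zA x Ax /=; rewrite ler_pM2l//; exact: zA.
- by move=> u t s ut ts x Ax /=; apply: (le_trans _ ts); exact: ut.
Qed.

(** The weak-* closed counterpart of the ball of centre [y] and radius [e]: the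
functionals exceeding the attached level by [e] on the whole ball. *)
Definition level_box (y : V) (e : R) : set (dual_space V * R^o) :=
  [set z : dual_space V * R^o | forall y', `|y - y'| < e -> z.2 + e <= z.1 y'].

Lemma closed_level_box y e : closed (level_box y e).
Proof.
rewrite (_ : level_box y e = \bigcap_(y' in [set y' | `|y - y'| < e])
   [set z : dual_space V * R^o | z.2 + e <= z.1 y'])//.
by apply: closed_bigI => y' _; exact: closed_dual_le.
Qed.

(** The margin [1/(k+1)] keeps the level box closed while the boxes cover the
strict inequality [t < u x].  With [g] half the gap between [t] and [u x], and
[d] the radius of a ball around [x] on which [u] varies by less than [g], it is
enough that [1/(k+1)] be less than [g] and [d / 2]: the ball of radius [1/(k+1)]
around a point [c n] close to [x] then lies in the one of radius [d]. *)
Lemma dual_gt_level_box (c : nat -> V) (x : V) (u : dual_space V) (t : R) :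
  (forall x e, 0 < e -> exists n, `|x - c n| < e) ->
  t < u x <->
  exists n k, ball (c n) k.+1%:R^-1 x /\ level_box (c n) k.+1%:R^-1 (u, t).
Proof.
move=> cd; split; last first.
  move=> [n [k [+ h]]]; rewrite -ball_normE /= => /h/=.
  by apply: lt_le_trans; rewrite ltrDl invS_gt0.
have halfway (a b e : R) : e < (a - t) / 2 -> a - b < (a - t) / 2 -> t + e <= b.
  by lra.
move=> tux; pose g := (u x - t) / 2.
have g0 : 0 < g by rewrite divr_gt0// subr_gt0.
have /cvgrPdist_lt/(_ g g0)/nbhs_normP[d /= d0 ud] := @dual_continuous _ _ u x.
have m0 : 0 < Num.min g (d / 2) by rewrite lt_min g0 divr_gt0.
have [k] := exists_invS_lt _ m0; rewrite lt_min => /andP[kg kd].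
have [n xn] := cd x _ (invS_gt0 k).
exists n, k; rewrite -ball_normE /= distrC; split=> // y cy /=.
have : `|u x - u y| < g.
  apply: ud; rewrite /= -(subrK (c n) x) -addrA.
  by rewrite (le_lt_trans (ler_normD _ _))// [ltRHS]splitr ltrD// (lt_trans _ kd).
rewrite ltr_norml => /andP[_]; move: kg; rewrite /g; exact: halfway.
Qed.

End duality.

(** * Measurability of graphs *)

Section Borel_sections.
Context {d : measure_display} {Omega : measurableType d} {S : ptopologicalType}.

Lemma open_measurable_Borel (U : set S) : open U ->
  measurable (U : set (borelType S)).
Proof. exact: sub_sigma_algebra. Qed.

Lemma closed_measurable_Borel (F : set S) : closed F ->
  measurable (F : set (borelType S)).
Proof.
move=> clF; rewrite -[F]setCK; apply: measurableC.
by apply: open_measurable_Borel; exact: closed_openC.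
Qed.

Lemma graph_measurableI (X : Omega -> set S) (B : set S) :
  graph_measurable X -> measurable (B : set (borelType S)) ->
  graph_measurable (fun w => X w `&` B).
Proof.
move=> gX mB; rewrite /graph_measurable.
have mTB : measurable ([set: Omega] `*` (B : set (borelType S))).
  exact: measurableX.
rewrite (_ : [set _ | _] = [set z : Omega * borelType S | X z.1 z.2] `&`
    ([set: Omega] `*` (B : set (borelType S)))).
  exact: measurableI.
by apply/seteqP; split=> -[w s] /= [Xs]; [split|case].
Qed.

(** Both directions of the equivalence use this form, with the balls and the
level boxes exchanging their roles. *)
Lemma graph_measurable_compl (X : Omega -> set S) (E : nat -> nat -> set Omega)
    (B : nat -> nat -> set S) :
  (forall n k, measurable (E n k)) ->
  (forall n k, measurable (B n k : set (borelType S))) ->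
  (forall w s, ~ X w s <-> exists n k, E n k w /\ B n k s) ->
  graph_measurable X.
Proof.
move=> mE mB XEB; rewrite /graph_measurable -[X in measurable X]setCK.
apply: measurableC.
rewrite (_ : ~` _ = \bigcup_n \bigcup_k (E n k `*` (B n k : set (borelType S)))).
  apply: bigcupT_measurable => n; apply: bigcupT_measurable => k.
  exact: measurableX.
apply/seteqP; split=> -[w s] /=.
  by move=> /XEB[n [k [? ?]]]; exists n => //; exists k.
by move=> [n _ [k _ [? ?]]]; apply/XEB; exists n, k.
Qed.

End Borel_sections.

Theorem theorem3p7 (R : realType) (V : completeNormedModType R)
    (sepV : separable V)
    (d : measure_display) (Omega : measurableType d)
    (P : probability Omega R) (completeP : measure_is_complete P)
    (X : Omega -> set V)
    (closedX : forall w, closed (X w))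
    (convexX : forall w, convex_set (X w)) :
  graph_measurable X <->
  random_closed_set P (fun w => epi (support_function (X w))) /\
  (forall w, epi_family (epi (support_function (X w)))).
Proof.
have [c cd] := separable_dense_sequence sepV.
have mball n k : measurable (ball (c n) k.+1%:R^-1 : set (borelType V)).
  by apply: open_measurable_Borel; apply: ball_open; exact: invS_gt0.
have mbox n k : measurable (level_box (c n) k.+1%:R^-1 :
    set (borelType (dual_space V * R^o)%type)).
  by apply: closed_measurable_Borel; exact: closed_level_box.
split=> [gX|[[gE _] _]].
- have epiF w := epi_support_function_family (X w).
  split=> //; split; last by apply/aeW => w; case: (epiF w).
  have [C coverC] := Banach_complete_cover sepV.
  apply: (graph_measurable_compl _ _ _ _ mbox) => [n k|w [u t]].
    exact: (measurable_projection _ completeP _ _ coverC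
      (graph_measurableI _ _ gX (mball n k))).
  rewrite epi_support_functionE; split.
    move=> /existsNP[x /not_implyP[Xx /negP]] /=; rewrite -ltNge.
    move=> /(dual_gt_level_box _ _ _ _ cd)[n [k [xB uG]]].
    by exists n, k; split=> //; exists x.
  move=> [n [k [[x [Xx xB]] uG]]] /(_ x Xx)/=; apply/negP; rewrite -ltNge.
  by apply/(dual_gt_level_box _ _ _ _ cd); exists n, k.
- apply: (graph_measurable_compl _ _ _ _ mball) => [n k|w x].
    exact: (measurable_projection _ completeP _ _
      (weak_dual_complete_cover _ _ cd)
      (graph_measurableI _ _ gE (mbox n k))).
  split=> [nXx|[n [k [[[u t] [+ uG]] xB]]]].
    have [u [t [Xt tx]]] :=
      convex_closed_separation _ _ (closedX w) (convexX w) nXx.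
    have [n [k [xB uG]]] := (dual_gt_level_box _ _ _ _ cd).1 tx.
    by exists n, k; split=> //; exists (u, t); rewrite epi_support_functionE.
  rewrite epi_support_functionE => ut Xx; have := ut x Xx => /=.
  apply/negP; rewrite -ltNge.
  by apply/(dual_gt_level_box _ _ _ _ cd); exists n, k.
Qed.
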